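(* Let $\mathcal{S}$ be a mutation class of labelled seeds (cluster structure). The cluster modular groupoid $\operatorname{CMG}(\mathcal{S})$ and the orbit groupoid $W^+\backslash\mathcal{S}$ are isomorphic.
   Context: Fix $n\ge 1$, $I=\{1,\dots,n\}$, a purely transcendental field extension $\mathcal{F}$ of $\mathbb{Q}$ of transcendence degree $n$, and $\mathcal{K}=\mathbb{Q}(x_1,\dots,x_n)$. A quiver $Q$ on $I$ (without loops or 2-cycles) is the data of its adjacency matrix $(a_{ij})_{i,j\in I}$ of non-negative integers, $a_{ij}$ being the multiplicity of the arrow $i\to j$, with $a_{ii}=0$ and $a_{ij}a_{ji}=0$; two quivers are equal iff their adjacency matrices are. It is determined by $b_{ij}=a_{ij}-a_{ji}$. A labelled seed is a pair $(Q,\beta)$ with $Q$ a quiver on $I$ and $\beta\in\mathcal{F}^n$ freely generating $\mathcal{F}$; $\beta$ is also regarded as the isomorphism $\mathcal{K}\to\mathcal{F}$, $x_i\mapsto\beta_i$. Write $x=(Q_x,\beta_x)$ for a labelled seed $x$. Mutation at $i$: $(Q,\beta)\cdot\mu_i=(Q\cdot\mu_i,\beta')$, where $Q\cdot\mu_i$ has $b'_{jk}=-b_{jk}$ if $i\in\{j,k\}$ and $b'_{jk}=b_{jk}+a_{ji}a_{ik}-a_{ki}a_{ij}$ otherwise, and $\beta'_j=\beta_j$ for $j\neq i$, $\beta'_i=\big(\prod_{k}\beta_k^{a_{ki}}+\prod_{k}\beta_k^{a_{ik}}\big)/\beta_i$. Relabelling: for $\sigma\in\mathfrak{S}_n$,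 $(Q,\beta)\cdot\sigma=(Q^\sigma,\beta^\sigma)$ with $\beta^\sigma_i=\beta_{\sigma(i)}$, and $Q\cdot\sigma=Q^\sigma$ with adjacency matrix $a^\sigma_{ij}=a_{\sigma(i)\sigma(j)}$. These combine to right actions, on labelled seeds and on quivers, of the mutation group $M_n=\mathfrak{S}_n\ltimes\langle\mu_1,\dots,\mu_n:\mu_i^2=1\rangle$, in which $\sigma\mu_i=\mu_{\sigma(i)}\sigma$. A mutation class (cluster structure) is an $M_n$-orbit $\mathcal{S}$ of labelled seeds. For a quiver $Q$ on $I$ and $g\in M_n$, let $\alpha_g^Q\in\operatorname{Aut}(\mathcal{K})$ be the automorphism such that $\beta'=\beta\circ\alpha_g^Q$ whenever $(Q',\beta')=(Q,\beta)\cdot g$; it depends only on $g$ and $Q$. Explicitly $\alpha_{\mu_i}^Q(x_j)=x_j$ for $j\ne i$, $\alpha_{\mu_i}^Q(x_i)=\big(\prod_k x_k^{a_{ki}}+\prod_k x_k^{a_{ik}}\big)/x_i$, $\alpha_\sigma^Q(x_i)=x_{\sigma(i)}$, and $\alpha_{gh}^Q=\alpha_g^Q\circ\alpha_h^{Q\cdot g}$. $\operatorname{CMG}(\mathcal{S})$ is the groupoid whose objects are the quivers occurring in labelled seeds of $\mathcal{S}$, whose morphisms $Q_1\to Q_2$ are formal symbols $\langle Q_1,g\rangle$ for $g\in M_n$ with $Q_1\cdot g=Q_2$, subject to $\langle Q_1,g\rangle=\langle Q_1,h\rangle\iff\alpha_g^{Q_1}=\alpha_h^{Q_1}$, with left-to-right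 composition $\langle Q,g\rangle*\langle Q\cdot g,h\rangle=\langle Q,gh\rangle$. $\operatorname{Aut}_{M_n}(\mathcal{S})$ is the group of bijections $\mathcal{S}\to\mathcal{S}$ commuting with the $M_n$-action, acting on the left. $W^+$ is the subgroup of all $w\in\operatorname{Aut}_{M_n}(\mathcal{S})$ with $Q_{w\cdot x}=Q_x$ for all $x\in\mathcal{S}$; its orbits on $\mathcal{S}$ are exactly the classes of labelled seeds with equal quivers. For a group $W$ acting on the left of a set $X$, the orbit groupoid $W\backslash X$ has as objects the $W$-orbits in $X$ and as morphisms $[x]\to[y]$ the bijections $[x]\to[y]$ commuting with the $W$-action, with left-to-right composition $\varphi*\psi=\psi\circ\varphi$. *)

(* Defs.v *)
From HB Require Import structures.
From mathcomp Require Import all_boot all_order all_algebra all_fingroup.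
From mathcomp Require Import fraction generic_quotient boolp mpoly.
From mathcomp Require Import zify.

Set Implicit Arguments.
Unset Strict Implicit.
Unset Printing Implicit Defensive.

Import Order.TTheory GRing.Theory Num.Theory.
Local Open Scope ring_scope.
Local Open Scope quotient_scope.

Definition is_quiver n (a : 'M[nat]_n) : bool :=
  [forall i, a i i == 0%N] && [forall i, forall j, (a i j * a j i == 0)%N].

Record quiver n := Quiver { adj :> 'M[nat]_n; _ : is_quiver adj }.

HB.instance Definition _ n := [isSub for @adj n].
HB.instance Definition _ n := [Choice of quiver n by <:].

Definition bmx n (Q : quiver n) (i j : 'I_n) : int := (Q i j)%:Z - (Q j i)%:Z.

Lemma adj_diag n (Q : quiver n) i : Q i i = 0%N.
Proof. by case: Q => a /= /andP[/forallP/(_ i)/eqP]. Qed.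

Lemma adj_2cycle n (Q : quiver n) i j : (Q i j * Q j i = 0)%N.
Proof. by case: Q => a /= /andP[_ /forallP/(_ i)/forallP/(_ j)/eqP]. Qed.

Definition posz (z : int) : nat := if 0 <= z then `|z|%N else 0%N.

Lemma posz_bmx n (Q : quiver n) i j : posz (bmx Q i j) = Q i j.
Proof. by rewrite /posz /bmx; have := adj_2cycle Q i j; case: ifP; nia. Qed.

Lemma bmx_inj n (Q Q' : quiver n) :
  (forall i j, bmx Q i j = bmx Q' i j) -> Q = Q'.
Proof.
by move=> e; apply/val_inj/matrixP => i j; rewrite -2!posz_bmx e.
Qed.

Definition bmx_mut n (Q : quiver n) (i j k : 'I_n) : int :=
  if (i == j) || (i == k) then - bmx Q j k
  else bmx Q j k + (Q j i * Q i k)%:Z - (Q k i * Q i j)%:Z.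

Lemma bmx_mutN n (Q : quiver n) i j k : bmx_mut Q i k j = - bmx_mut Q i j k.
Proof. by rewrite /bmx_mut orbC /bmx; case: ifP => _; lia. Qed.

Lemma quiver_mut_subproof n (Q : quiver n) i :
  is_quiver (\matrix_(j, k) posz (bmx_mut Q i j k)).
Proof.
apply/andP; split; apply/forallP => j; [|apply/forallP => k]; rewrite !mxE.
  by have := bmx_mutN Q i j j; rewrite /posz; case: ifP; lia.
by have := bmx_mutN Q i j k; rewrite /posz; do 2 case: ifP; nia.
Qed.

(* The quiver Q . mu_i; the arrows j -> k are the positive part of b'_jk. *)
Definition quiver_mut n (i : 'I_n) (Q : quiver n) : quiver n :=
  Quiver (quiver_mut_subproof Q i).

Lemma quiver_perm_subproof n (Q : quiver n) (s : {perm 'I_n}) :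
  is_quiver (\matrix_(i, j) Q (s i) (s j)).
Proof.
apply/andP; split; apply/forallP => j; [|apply/forallP => k]; rewrite !mxE.
  by rewrite adj_diag.
by rewrite adj_2cycle.
Qed.

Definition quiver_perm n (s : {perm 'I_n}) (Q : quiver n) : quiver n :=
  Quiver (quiver_perm_subproof Q s).

Lemma bmx_quiver_mut n (Q : quiver n) i j k :
  bmx (quiver_mut i Q) j k = bmx_mut Q i j k.
Proof.
rewrite /bmx !mxE (bmx_mutN _ _ j k) /posz.
by do 2 case: ifP; lia.
Qed.

Lemma adj_mut_l n (Q : quiver n) i k : quiver_mut i Q i k = Q k i.
Proof.
by rewrite -posz_bmx bmx_quiver_mut /bmx_mut eqxx /= -posz_bmx; congr posz;
  rewrite /bmx; lia.
Qed.

Lemma adj_mut_r n (Q : quiver n) i k : quiver_mut i Q k i = Q i k.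
Proof.
by rewrite -posz_bmx bmx_quiver_mut /bmx_mut eqxx orbT /= -posz_bmx;
  congr posz; rewrite /bmx; lia.
Qed.

Lemma quiver_mutK n (i : 'I_n) : involutive (quiver_mut i).
Proof.
move=> Q; apply: bmx_inj => j k; rewrite bmx_quiver_mut /bmx_mut.
case: ifP => ijk; first by rewrite bmx_quiver_mut /bmx_mut ijk opprK.
rewrite bmx_quiver_mut /bmx_mut ijk !adj_mut_l !adj_mut_r; lia.
Qed.

Lemma quiver_perm1 n (Q : quiver n) : quiver_perm 1%g Q = Q.
Proof. by apply/val_inj/matrixP => i j; rewrite mxE !perm1. Qed.

Lemma quiver_permM n (s t : {perm 'I_n}) (Q : quiver n) :
  quiver_perm t (quiver_perm s Q) = quiver_perm (t * s)%g Q.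
Proof. by apply/val_inj/matrixP => i j; rewrite !mxE !permM. Qed.

Lemma quiver_mut_perm n i (s : {perm 'I_n}) (Q : quiver n) :
  quiver_mut i (quiver_perm s Q) = quiver_perm s (quiver_mut (s i) Q).
Proof.
apply/val_inj/matrixP => j k; rewrite !mxE; congr posz.
by rewrite /bmx_mut !(inj_eq perm_inj) /bmx !mxE.
Qed.

(* An element w . s is stored in normal form: w is a word in the letters
   mu_0, ..., mu_(n-1) without two equal adjacent letters, that is, an element
   of the free product of n copies of Z/2, and s is a permutation. *)
Definition reduced n (w : seq 'I_n) : bool := sorted [rel i j | i != j] w.

Record mutgrp n := MutGrp {
  mutgrp_val :> seq 'I_n * {perm 'I_n};
  _ : reduced mutgrp_val.1
}.

HB.instance Definition _ n := [isSub for @mutgrp_val n].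
HB.instance Definition _ n := [Choice of mutgrp n by <:].

Definition cons_letter n (i : 'I_n) (w : seq 'I_n) : seq 'I_n :=
  if w is j :: w' then if i == j then w' else i :: w else [:: i].

Definition word_mul n (w v : seq 'I_n) : seq 'I_n :=
  foldr (@cons_letter n) v w.

Lemma reduced_behead n i (w : seq 'I_n) : reduced (i :: w) -> reduced w.
Proof. by move/path_sorted. Qed.

Lemma reduced_cons n i (w : seq 'I_n) : reduced w -> reduced (cons_letter i w).
Proof.
case: w => //= j w rw; case: eqP => [_|/eqP ij]; first exact: path_sorted rw.
by rewrite /reduced /= ij.
Qed.

Lemma reduced_mul n (w v : seq 'I_n) : reduced v -> reduced (word_mul w v).
Proof. by move=> rv; elim: w => //= i w /reduced_cons. Qed.

Lemma cons_letterK n i (w : seq 'I_n) :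
  reduced w -> cons_letter i (cons_letter i w) = w.
Proof.
case: w => [_|j w] /=; first by rewrite eqxx.
case: eqP => [-> {i}|]; last by rewrite /= eqxx.
by case: w => //= k w /andP[/negPf->].
Qed.

Lemma word_mul_cons n i (w v : seq 'I_n) : reduced v ->
  word_mul (cons_letter i w) v = cons_letter i (word_mul w v).
Proof.
move=> rv; case: w => //= j w; case: eqP => // ->.
by rewrite cons_letterK // reduced_mul.
Qed.

Lemma word_mulA n (w v u : seq 'I_n) : reduced u ->
  word_mul w (word_mul v u) = word_mul (word_mul w v) u.
Proof. by move=> ru; elim: w => //= i w ->; rewrite word_mul_cons. Qed.

Lemma word_mul0 n (w : seq 'I_n) : reduced w -> word_mul w [::] = w.
Proof.
elim: w => //= i w ih rw; rewrite ih ?(reduced_behead rw) //.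
by case: w rw {ih} => //= j w /andP[/negPf->].
Qed.

Lemma word_mul_rev n (w v : seq 'I_n) : reduced v ->
  word_mul (rev w) (word_mul w v) = v.
Proof.
move=> rv; elim: w => //= i w ih; rewrite rev_cons /word_mul foldr_rcons.
by rewrite cons_letterK ?reduced_mul.
Qed.

Lemma cons_letter_map n (s : {perm 'I_n}) i w :
  map s (cons_letter i w) = cons_letter (s i) (map s w).
Proof. by case: w => //= j w; rewrite (inj_eq perm_inj); case: eqP. Qed.

Lemma word_mul_map n (s : {perm 'I_n}) w v :
  map s (word_mul w v) = word_mul (map s w) (map s v).
Proof. by elim: w => //= i w ih; rewrite cons_letter_map ih. Qed.

Lemma reduced_map n (s : {perm 'I_n}) w : reduced (map s w) = reduced w.
Proof.
rewrite /reduced sorted_map; apply: eq_sorted => i j /=.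
by rewrite (inj_eq perm_inj).
Qed.

Lemma reduced_rev n (w : seq 'I_n) : reduced (rev w) = reduced w.
Proof. by rewrite /reduced rev_sorted; apply: eq_sorted => i j /=; rewrite eq_sym. Qed.

Section MutGroup.
Variable n : nat.
Implicit Types g h k : mutgrp n.

Lemma mutgrpP g : reduced g.1. Proof. by case: g. Qed.
Hint Resolve mutgrpP : core.

Definition mutgrp_one : mutgrp n := @MutGrp n ([::], 1%g) isT.

Lemma mutgrp_mul_subproof g h : reduced (word_mul g.1 (map g.2 h.1)).
Proof. by rewrite reduced_mul // reduced_map. Qed.

(* (w s)(v t) = (w s(v)) (s t) since s mu_i = mu_(s i) s.  The product s t of
   the symmetric group is here the composite "t, then s", which the library
   writes t * s. *)
Definition mutgrp_mul g h : mutgrp n :=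
  @MutGrp n (word_mul g.1 (map g.2 h.1), (h.2 * g.2)%g)
    (mutgrp_mul_subproof g h).

Lemma mutgrp_inv_subproof g : reduced (map (g.2^-1)%g (rev g.1)).
Proof. by rewrite reduced_map reduced_rev. Qed.

Definition mutgrp_inv g : mutgrp n :=
  @MutGrp n (map (g.2^-1)%g (rev g.1), (g.2^-1)%g) (mutgrp_inv_subproof g).

Lemma mutgrp_mulA : associative mutgrp_mul.
Proof.
move=> g h k; apply/val_inj; congr pair; last by rewrite /= mulgA.
rewrite /= word_mul_map word_mulA ?reduced_map // -map_comp.
by congr word_mul; apply: eq_map => i /=; rewrite permM.
Qed.

Lemma mutgrp_mul1 : left_id mutgrp_one mutgrp_mul.
Proof.
move=> g; apply/val_inj; rewrite /= mulg1 (eq_map (@perm1 _)) map_id.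
by case: (val g).
Qed.

Lemma mutgrp_1mul : right_id mutgrp_one mutgrp_mul.
Proof.
move=> g; apply/val_inj; rewrite /= mul1g word_mul0 //.
by case: (mutgrp_val g).
Qed.

Lemma mutgrp_mulV : left_inverse mutgrp_one mutgrp_inv mutgrp_mul.
Proof.
move=> g; apply/val_inj; rewrite /= mulgV -word_mul_map; congr pair.
by rewrite -[X in word_mul _ X]word_mul0 // word_mul_rev.
Qed.

Lemma mutgrp_Vmul : right_inverse mutgrp_one mutgrp_inv mutgrp_mul.
Proof.
move=> g; apply/val_inj; rewrite /= mulVg -map_comp; congr pair.
rewrite (_ : map _ _ = rev g.1); last first.
  by rewrite -[RHS]map_id; apply: eq_map => i /=; rewrite permKV.
rewrite -[X in word_mul X _]revK -[X in word_mul _ X]word_mul0 ?reduced_rev //.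
by rewrite word_mul_rev.
Qed.

HB.instance Definition _ := isGroup.Build (mutgrp n)
  mutgrp_mulA mutgrp_mul1 mutgrp_1mul mutgrp_mulV mutgrp_Vmul.

End MutGroup.

#[global] Hint Resolve mutgrpP : core.

(* The right action of the mutation group on X determined by the actions
   mu of the generators mu_i and perm of the symmetric group. *)
Definition mutgrp_act n (X : Type) (mu : 'I_n -> X -> X)
    (perm : {perm 'I_n} -> X -> X) (x : X) (g : mutgrp n) : X :=
  perm g.2 (foldl (fun y i => mu i y) x g.1).

Section MutAction.
Variables (n : nat) (X : Type) (mu : 'I_n -> X -> X).
Variable (perm : {perm 'I_n} -> X -> X).
Hypothesis muK : forall i, involutive (mu i).
Hypothesis perm1 : forall x, perm 1%g x = x.
Hypothesis permM : forall s t x, perm t (perm s x) = perm (t * s)%g x.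
Hypothesis mu_perm : forall i s x, mu i (perm s x) = perm s (mu (s i) x).

Local Notation word_act := (foldl (fun y i => mu i y)).

Lemma word_act_cons x i w : word_act x (cons_letter i w) = word_act (mu i x) w.
Proof. by case: w => //= j w; case: eqP => //= ->; rewrite muK. Qed.

Lemma word_act_mul x w v : word_act x (word_mul w v) = word_act (word_act x w) v.
Proof. by elim: w x => //= i w ih x; rewrite word_act_cons ih. Qed.

Lemma word_act_perm x s w :
  word_act (perm s x) w = perm s (word_act x (map s w)).
Proof. by elim: w x => //= i w ih x; rewrite mu_perm ih. Qed.

Lemma mutgrp_act1 x : mutgrp_act mu perm x 1%g = x.
Proof. exact: perm1. Qed.

Lemma mutgrp_actM x g h :
  mutgrp_act mu perm x (g * h)%g = mutgrp_act mu perm (mutgrp_act mu perm x g) h.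
Proof. by rewrite /mutgrp_act /= word_act_mul word_act_perm permM. Qed.

End MutAction.

Definition quiver_act n : quiver n -> mutgrp n -> quiver n :=
  mutgrp_act (@quiver_mut n) (@quiver_perm n).

Lemma quiver_act1 n (Q : quiver n) : quiver_act Q 1%g = Q.
Proof. exact/mutgrp_act1/quiver_perm1. Qed.

Lemma quiver_actM n (Q : quiver n) g h :
  quiver_act Q (g * h)%g = quiver_act (quiver_act Q g) h.
Proof.
apply: mutgrp_actM; [exact: quiver_mutK|exact: quiver_permM|].
exact: quiver_mut_perm.
Qed.

Section FreeGenerators.
Variables (n : nat) (F : fieldType) (iota : {rmorphism rat -> F}).

(* b is algebraically independent over Q and F = Q(b). *)
Definition freely_generates (b : 'I_n -> F) : Prop :=
  (forall p : {mpoly rat[n]}, mmap iota b p = 0 -> p = 0) /\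
  (forall z : F, exists p q : {mpoly rat[n]},
     mmap iota b q <> 0 /\ z = mmap iota b p / mmap iota b q).

(* F is purely transcendental over Q, of transcendence degree n. *)
Definition purely_transcendental : Prop :=
  exists b : 'I_n -> F, freely_generates b.

Record seed := Seed {
  seed_quiver : quiver n;
  cluster : {ffun 'I_n -> F};
  seedP : freely_generates cluster
}.

Lemma seed_eq x y :
  seed_quiver x = seed_quiver y -> cluster x = cluster y -> x = y.
Proof.
case: x y => [Q b bP] [Q' b' b'P] /= eQ eb; subst Q' b'.
by rewrite (Prop_irrelevance bP b'P).
Qed.

Definition exchange_num (Q : quiver n) (i : 'I_n) (b : {ffun 'I_n -> F}) : F :=
  \prod_k b k ^+ Q k i + \prod_k b k ^+ Q i k.

Definition exchange (Q : quiver n) (i : 'I_n) (b : {ffun 'I_n -> F}) :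
    {ffun 'I_n -> F} :=
  [ffun j => if j == i then exchange_num Q i b / b i else b j].

Lemma exchange_num_exchange Q i b :
  exchange_num Q i (exchange Q i b) = exchange_num Q i b.
Proof.
by congr (_ + _); apply: eq_bigr => k _; rewrite ffunE; case: eqP => // ->;
  rewrite adj_diag !expr0.
Qed.

Lemma exchange_mut Q i : exchange (quiver_mut i Q) i = exchange Q i.
Proof.
apply/funext => b; apply/ffunP => j; rewrite !ffunE /exchange_num addrC.
case: ifP => // _; congr ((_ + _) / _); apply: eq_bigr => k _.
  by rewrite adj_mut_l.
by rewrite adj_mut_r.
Qed.

Definition num_poly (Q : quiver n) (i : 'I_n) : {mpoly rat[n]} :=
  \prod_k 'X_k ^+ Q k i + \prod_k 'X_k ^+ Q i k.

Lemma mmap_var (b : 'I_n -> F) i :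
  mmap iota b ('X_i : {mpoly rat[n]}) = b i.
Proof. by rewrite mmapX mmap1U. Qed.

Lemma mmap_num_poly Q i (b : {ffun 'I_n -> F}) :
  mmap iota b (num_poly Q i) = exchange_num Q i b.
Proof.
by rewrite rmorphD !rmorph_prod; congr (_ + _); apply: eq_bigr => k _;
  rewrite rmorphXn /= mmap_var.
Qed.

Lemma num_poly_neq0 Q i : num_poly Q i <> 0.
Proof.
move=> /(congr1 (meval (fun=> 1))); rewrite rmorphD !rmorph_prod rmorph0 /=.
by rewrite !big1 // => k _; rewrite rmorphXn /= mevalXU expr1n.
Qed.

Lemma free_neq0 b i : freely_generates b -> b i != 0.
Proof.
move=> [bI _]; apply/eqP => bi0; have := bI 'X_i.
rewrite mmap_var bi0 => /(_ erefl) /(congr1 (meval (fun=> 1))).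
by rewrite mevalXU rmorph0; apply/eqP; rewrite oner_eq0.
Qed.

Lemma free_num_neq0 Q i (b : {ffun 'I_n -> F}) :
  freely_generates b -> exchange_num Q i b != 0.
Proof.
by move=> [bI _]; apply/eqP => e; apply: (@num_poly_neq0 Q i); apply: bI;
  rewrite mmap_num_poly.
Qed.

Lemma exchangeK Q i (b : {ffun 'I_n -> F}) :
  b i != 0 -> exchange_num Q i b != 0 -> exchange Q i (exchange Q i b) = b.
Proof.
move=> bi0 e0; apply/ffunP => j; rewrite ffunE exchange_num_exchange !ffunE.
by rewrite eqxx; case: eqP => // ->; rewrite invf_div mulrCA divff ?mulr1.
Qed.

Lemma clear_denominators Q i (p : {mpoly rat[n]}) : exists N r,
  forall b : {ffun 'I_n -> F}, b i != 0 ->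
    mmap iota (exchange Q i b) p * b i ^+ N = mmap iota b r.
Proof.
pose ok p := exists N r, forall b : {ffun 'I_n -> F}, b i != 0 ->
    mmap iota (exchange Q i b) p * b i ^+ N = mmap iota b r.
have okC c : ok c%:MP_[n].
  by exists 0%N, c%:MP_[n] => b _; rewrite !mmapC mulr1.
have okM p1 p2 : ok p1 -> ok p2 -> ok (p1 * p2).
  move=> [N1 [r1 h1]] [N2 [r2 h2]]; exists (N1 + N2)%N, (r1 * r2) => b bi0.
  by rewrite !rmorphM /= exprD mulrACA h1 // h2.
have okD p1 p2 : ok p1 -> ok p2 -> ok (p1 + p2).
  move=> [N1 [r1 h1]] [N2 [r2 h2]].
  exists (N1 + N2)%N, (r1 * 'X_i ^+ N2 + r2 * 'X_i ^+ N1) => b bi0.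
  rewrite !rmorphD !rmorphM !rmorphXn /= !mmap_var -h1 // -h2 //.
  by rewrite mulrDl -!mulrA -!exprD [(N2 + N1)%N]addnC.
have okX k : ok 'X_k.
  case: (eqVneq k i) => [->|ki].
    exists 1%N, (num_poly Q i) => b bi0.
    by rewrite mmap_var mmap_num_poly ffunE eqxx mulfVK.
  by exists 0%N, 'X_k => b _; rewrite !mmap_var ffunE (negPf ki) mulr1.
rewrite -/(ok p); elim/mpolyind: p => [|c m p _ _ okp].
  by rewrite -mpolyC0; apply: okC.
apply: (okD) => //; rewrite -mul_mpolyC; apply: (okM) => //.
rewrite mpolyXE_id; apply: (big_ind ok) => [|p1 p2|k _].
- by rewrite -mpolyC1; apply: okC.
- exact: okM.
elim: (m k) => [|d ih]; first by rewrite expr0 -mpolyC1; apply: okC.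
by rewrite exprS; apply: okM.
Qed.

Lemma exchange_free Q i (b : {ffun 'I_n -> F}) :
  freely_generates b -> freely_generates (exchange Q i b).
Proof.
move=> bF; have b0 := free_neq0 i bF; have e0 := free_num_neq0 Q i bF.
have bK := exchangeK b0 e0; set b' := exchange Q i b in bK *.
have b'0 : b' i != 0 by rewrite ffunE eqxx mulf_neq0 // invr_eq0.
case: bF => bI bG; split => [p p0|z].
  have [N [r rP]] := clear_denominators Q i p.
  have r0 : r = 0 by apply: bI; rewrite -rP // -/b' p0 mul0r.
  apply: bI; apply/eqP; have /eqP := rP _ b'0.
  by rewrite bK r0 rmorph0 mulf_eq0 expf_eq0 (negPf b'0) andbF orbF.
have [p [q [q0 ->]]] := bG z.
have [N [r /(_ _ b'0)]] := clear_denominators Q i p; rewrite bK => rP.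
have [M [s /(_ _ b'0)]] := clear_denominators Q i q; rewrite bK => sP.
have pw k : b' i ^+ k != 0 by rewrite expf_neq0.
exists (r * 'X_i ^+ M), (s * 'X_i ^+ N).
rewrite !rmorphM !rmorphXn /= mmap_var -rP -sP; split.
  by apply/eqP; rewrite !mulf_neq0 //; apply/eqP.
rewrite -(mulrA _ (b' i ^+ N)) -(mulrA _ (b' i ^+ M)) (mulrC (b' i ^+ M)).
rewrite -mulf_div.
by rewrite (divff (mulf_neq0 (pw N) (pw M))) mulr1.
Qed.

Definition seed_mut (i : 'I_n) (x : seed) : seed :=
  Seed (quiver_mut i (seed_quiver x))
    (exchange_free (seed_quiver x) i (seedP x)).

Lemma perm_free (s : {perm 'I_n}) (b : {ffun 'I_n -> F}) :
  freely_generates b -> freely_generates [ffun i => b (s i)].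
Proof.
have mmap_perm (t : {perm 'I_n}) (c : {ffun 'I_n -> F}) p :
    mmap iota [ffun i => c (t i)] p = mmap iota c (msym t p).
  elim/mpolyind: p => [|c0 m p _ _ ih]; first by rewrite !rmorph0.
  rewrite !rmorphD /= ih; congr (_ + _).
  rewrite msymZ !mmapZ msymX !mmapX; congr (_ * _); rewrite /mmap1.
  rewrite [RHS](reindex_inj (@perm_inj _ t)) /=; apply: eq_bigr => k _ /=.
  by rewrite ffunE mnmE permK.
move=> [bI bG]; split=> [p|z].
  rewrite mmap_perm => /bI /(congr1 (msym s^-1%g)).
  by rewrite -msymMm mulgV msym1m rmorph0.
have [p [q [q0 ->]]] := bG z; exists (msym s^-1%g p), (msym s^-1%g q).
by rewrite !mmap_perm -!msymMm mulVg !msym1m.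
Qed.

Definition seed_perm (s : {perm 'I_n}) (x : seed) : seed :=
  Seed (quiver_perm s (seed_quiver x)) (perm_free s (seedP x)).

Definition seed_act : seed -> mutgrp n -> seed :=
  mutgrp_act seed_mut seed_perm.

Lemma seed_mutK i : involutive (seed_mut i).
Proof.
move=> x; apply: seed_eq; first exact: quiver_mutK.
rewrite /= exchange_mut exchangeK //; first exact/free_neq0/seedP.
exact/free_num_neq0/seedP.
Qed.

Lemma seed_act1 x : seed_act x 1%g = x.
Proof.
apply: mutgrp_act1 => {}x; apply: seed_eq; first exact: quiver_perm1.
by apply/ffunP => i; rewrite ffunE perm1.
Qed.

Lemma seed_actM x g h : seed_act x (g * h)%g = seed_act (seed_act x g) h.
Proof.
apply: mutgrp_actM => [|s t {}x|i s {}x]; first exact: seed_mutK.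
  apply: seed_eq; first exact: quiver_permM.
  by apply/ffunP => i; rewrite !ffunE permM.
apply: seed_eq; first exact: quiver_mut_perm.
apply/ffunP => j; rewrite !ffunE /= (inj_eq perm_inj).
case: ifP => // _; congr (_ / _); rewrite /exchange_num.
by congr (_ + _); rewrite [RHS](reindex_inj (@perm_inj _ s)) /=;
  apply: eq_bigr => k _; rewrite ffunE mxE.
Qed.

Lemma seed_quiver_act x g :
  seed_quiver (seed_act x g) = quiver_act (seed_quiver x) g.
Proof.
rewrite /seed_act /quiver_act /mutgrp_act /=; congr quiver_perm.
by elim: (g.1) x => //= i w ih x; rewrite ih.
Qed.

End FreeGenerators.

Definition ratfun n : fieldType := {fraction {mpoly rat[n]}}.

Definition ratfun_const n : {rmorphism rat -> ratfun n} :=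
  (@tofrac {mpoly rat[n]} \o @mpolyC n rat)%FUN.

(* The cluster of x, as the isomorphism Q(x_1, ..., x_n) -> F. *)
Definition seed_iso n (F : fieldType) (iota : {rmorphism rat -> F})
    (x : seed n iota) (f : ratfun n) : F :=
  mmap iota (cluster x) \n_(repr f) / mmap iota (cluster x) \d_(repr f).

Section SeedIso.
Variables (n : nat) (F : fieldType) (iota : {rmorphism rat -> F}).
Implicit Types (x y : seed n iota) (p q : {mpoly rat[n]}) (f : ratfun n).

Lemma ratfunE f :
  f = tofrac \n_(repr f) / tofrac \d_(repr f) :> {fraction {mpoly rat[n]}}.
Proof.
have d0 : tofrac \d_(repr f) != 0 :> {fraction {mpoly rat[n]}}.
  by rewrite tofrac_eq0 denom_ratioP.
apply: (mulIf d0); rewrite divfK //.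
rewrite -[X in X * _ = _]reprK; unlock tofrac; rewrite -[LHS]pi_mul.
apply/eqmodP; rewrite /= /FracField.equivf /FracField.mulf /=.
rewrite !numden_Ratio ?oner_neq0 ?mulf_neq0 ?oner_neq0 ?denom_ratioP //.
by rewrite !mulr1 mulrC.
Qed.

Lemma ratfun_ind (P : ratfun n -> Prop) :
  (forall p q, q != 0 -> P (tofrac p / tofrac q)) -> forall f, P f.
Proof. by move=> h f; rewrite (ratfunE f); apply/h/denom_ratioP. Qed.

Lemma mmap_cluster_neq0 x q : q != 0 -> mmap iota (cluster x) q != 0.
Proof. by move=> q0; apply: contra q0 => /eqP/(seedP x).1 ->. Qed.

Lemma seed_iso_frac x p q : q != 0 ->
  seed_iso x (tofrac p / tofrac q) =
  mmap iota (cluster x) p / mmap iota (cluster x) q.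
Proof.
move=> q0; rewrite /seed_iso; set f : ratfun n := _ / _.
have d0 := denom_ratioP (repr f).
have /eqP := ratfunE f; rewrite {1}/f eqr_div ?tofrac_eq0 // -!tofracM tofrac_eq.
move=> /eqP/(congr1 (mmap iota (cluster x))); rewrite !rmorphM /= => e.
by apply/eqP; rewrite eqr_div ?mmap_cluster_neq0 // e.
Qed.

Lemma seed_iso_tofrac x p : seed_iso x (tofrac p) = mmap iota (cluster x) p.
Proof.
have := seed_iso_frac x p (oner_neq0 _).
by rewrite rmorph1 /= rmorph1 !divr1.
Qed.

Lemma seed_iso_zmod_morphism x : zmod_morphism (seed_iso x).
Proof.
elim/ratfun_ind => p q q0; elim/ratfun_ind => r s s0.
rewrite -mulNr addf_div ?tofrac_eq0 // -tofracN -!tofracM -tofracD.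
rewrite !seed_iso_frac ?mulf_neq0 // rmorphD !rmorphM rmorphN /=.
by rewrite -mulNr addf_div ?mmap_cluster_neq0.
Qed.

Lemma seed_iso_monoid_morphism x : monoid_morphism (seed_iso x).
Proof.
split; first by rewrite -tofrac1 seed_iso_tofrac rmorph1.
elim/ratfun_ind => p q q0; elim/ratfun_ind => r s s0.
rewrite mulf_div -!tofracM !seed_iso_frac ?mulf_neq0 // !rmorphM /=.
by rewrite mulf_div.
Qed.

HB.instance Definition _ x := GRing.isZmodMorphism.Build
  (ratfun n) F (seed_iso x) (seed_iso_zmod_morphism x).
HB.instance Definition _ x := GRing.isMonoidMorphism.Build
  (ratfun n) F (seed_iso x) (seed_iso_monoid_morphism x).

Lemma seed_iso_bij x : bijective (seed_iso x).
Proof.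
suff /choice[g gK] : forall z, exists f, seed_iso x f = z.
  by exists g => [f|z]; [apply: (fmorph_inj (seed_iso x)); apply: gK|].
move=> z; have [p [q [/eqP q0 ->]]] := (seedP x).2 z.
exists (tofrac p / tofrac q); apply: seed_iso_frac.
by apply: contra q0 => /eqP ->; rewrite rmorph0.
Qed.

End SeedIso.

Definition ratfun_var n (i : 'I_n) : ratfun n := tofrac 'X_i.

Lemma seed_iso_var n (F : fieldType) (iota : {rmorphism rat -> F})
  (x : seed n iota) i : seed_iso x (ratfun_var i) = cluster x i.
Proof. by rewrite /ratfun_var seed_iso_tofrac mmap_var. Qed.

Lemma mmap_ratfun_var n (p : {mpoly rat[n]}) :
  mmap (ratfun_const n) [ffun i => ratfun_var i] p = tofrac p.
Proof.
elim/mpolyind: p => [|c m p _ _ ih]; first by rewrite !rmorph0.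
rewrite rmorphD tofracD /= ih; congr (_ + _).
rewrite mmapZ -mul_mpolyC tofracM /=; congr (_ * _).
rewrite mmapX mpolyXE_id rmorph_prod /=; apply: eq_bigr => i _.
by rewrite ffunE rmorphXn.
Qed.

Lemma ratfun_var_free n :
  freely_generates (ratfun_const n) [ffun i => ratfun_var i].
Proof.
split=> [p|f].
  by rewrite mmap_ratfun_var => /eqP; rewrite tofrac_eq0 => /eqP.
exists \n_(repr f), \d_(repr f); rewrite !mmap_ratfun_var.
split; first by apply/eqP; rewrite tofrac_eq0 denom_ratioP.
exact: ratfunE.
Qed.

Definition initial_seed n (Q : quiver n) : seed n (ratfun_const n) :=
  Seed Q (ratfun_var_free n).

(* alpha_g^Q is the substitution of the cluster of (Q, (x_1, ..., x_n)) . g;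
   alphaE shows that it satisfies beta' = beta \o alpha_g^Q for all seeds, and
   alpha_mut, alpha_perm, alphaM give its explicit description. *)
Definition alpha n (Q : quiver n) (g : mutgrp n) : ratfun n -> ratfun n :=
  seed_iso (seed_act (initial_seed Q) g).

Section Alpha.
Variable n : nat.
Implicit Types (Q : quiver n) (g h : mutgrp n).

HB.instance Definition _ Q g := GRing.RMorphism.on (alpha Q g).

Lemma alpha_bij Q g : bijective (alpha Q g).
Proof. exact: seed_iso_bij. Qed.

Section Equivariance.
Variables (F : fieldType) (iota : {rmorphism rat -> F}) (z : seed n iota).

Lemma seed_iso_act_cluster (x : seed n iota) (y : seed n (ratfun_const n)) g :
  seed_quiver x = seed_quiver y ->
  (forall i, cluster x i = seed_iso z (cluster y i)) ->
  forall i, cluster (seed_act x g) i = seed_iso z (cluster (seed_act y g) i).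
Proof.
rewrite /seed_act /mutgrp_act; elim: (g.1) x y => [|j w ih] x y eQ eb.
  by move=> i; rewrite !ffunE eb.
apply: ih => [|i] /=; first by rewrite eQ.
rewrite !ffunE; case: ifP => // _; rewrite eQ eb fmorph_div rmorphD /=.
by rewrite !rmorph_prod /=; congr ((_ + _) / _); apply: eq_bigr => k _;
  rewrite rmorphXn /= eb.
Qed.

Lemma alphaE g : seed_iso (seed_act z g) = seed_iso z \o alpha (seed_quiver z) g.
Proof.
have mmapE (x : seed n iota) (y : seed n (ratfun_const n)) p :
    (forall i, cluster x i = seed_iso z (cluster y i)) ->
    mmap iota (cluster x) p = seed_iso z (mmap (ratfun_const n) (cluster y) p).
  move=> e; elim/mpolyind: p => [|c m p _ _ ih]; first by rewrite !rmorph0.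
  rewrite !rmorphD /= ih; congr (_ + _).
  rewrite !mmapZ rmorphM /= seed_iso_tofrac mmapC; congr (_ * _).
  rewrite !mmapX /mmap1 rmorph_prod /=; apply: eq_bigr => k _.
  by rewrite rmorphXn /= e.
have e p := mmapE _ _ p (@seed_iso_act_cluster z
  (initial_seed (seed_quiver z)) g erefl _).
apply/funext; elim/ratfun_ind => p q q0.
rewrite [RHS](congr1 (seed_iso z) (seed_iso_frac _ p q0)) seed_iso_frac //.
by rewrite fmorph_div !e // => i; rewrite ffunE seed_iso_var.
Qed.

End Equivariance.

Lemma seed_iso_initial Q : seed_iso (initial_seed Q) = id.
Proof.
apply/funext; elim/ratfun_ind => p q q0.
by rewrite seed_iso_frac // !mmap_ratfun_var.
Qed.

Lemma alpha1 Q : alpha Q 1%g = id.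
Proof. by rewrite /alpha seed_act1 seed_iso_initial. Qed.

Lemma alphaM Q g h : alpha Q (g * h)%g = alpha Q g \o alpha (quiver_act Q g) h.
Proof. by rewrite /alpha seed_actM alphaE seed_quiver_act. Qed.

Definition mu_elt (i : 'I_n) : mutgrp n := @MutGrp n ([:: i], 1%g) isT.

Definition perm_elt (s : {perm 'I_n}) : mutgrp n := @MutGrp n ([::], s) isT.

Lemma alpha_mut Q i j : alpha Q (mu_elt i) (ratfun_var j) =
  if j == i then
    (\prod_k ratfun_var k ^+ Q k i + \prod_k ratfun_var k ^+ Q i k)
      / ratfun_var i
  else ratfun_var j.
Proof.
rewrite [LHS]seed_iso_var /seed_act /mutgrp_act /= !ffunE perm1; case: ifP => // _.
by congr ((_ + _) / _); apply: eq_bigr => k _; rewrite ffunE.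
Qed.

Lemma alpha_perm Q s j : alpha Q (perm_elt s) (ratfun_var j) = ratfun_var (s j).
Proof. by rewrite [LHS]seed_iso_var /seed_act /mutgrp_act /= !ffunE. Qed.

End Alpha.

(* Composition is written from left to right. *)

Record groupoid := Groupoid {
  obj : Type;
  hom : obj -> obj -> Type;
  idm : forall a, hom a a;
  mcomp : forall a b c, hom a b -> hom b c -> hom a c;
  invm : forall a b, hom a b -> hom b a;
  compA : forall a b c d (f : hom a b) (g : hom b c) (h : hom c d),
    mcomp f (mcomp g h) = mcomp (mcomp f g) h;
  comp1m : forall a b (f : hom a b), mcomp (idm a) f = f;
  compm1 : forall a b (f : hom a b), mcomp f (idm b) = f;
  compmV : forall a b (f : hom a b), mcomp f (invm f) = idm a;
  compVm : forall a b (f : hom a b), mcomp (invm f) f = idm b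
}.

Record groupoid_functor (C D : groupoid) := GroupoidFunctor {
  fobj : obj C -> obj D;
  fhom : forall a b, hom a b -> hom (fobj a) (fobj b);
  fhom_id : forall a, fhom (idm a) = idm (fobj a);
  fhom_comp : forall a b c (f : hom a b) (g : hom b c),
    fhom (mcomp f g) = mcomp (fhom f) (fhom g)
}.

(* A functor is invertible iff it is bijective on objects and on morphisms. *)
Definition groupoid_isomorphic (C D : groupoid) : Prop :=
  exists Phi : groupoid_functor C D,
    bijective (fobj Phi) /\ (forall a b, bijective (@fhom _ _ Phi a b)).

Record left_action (W : groupType) (X : Type) := LeftAction {
  lact :> W -> X -> X;
  lact1 : forall x, lact 1%g x = x;
  lactM : forall v w x, lact (v * w)%g x = lact v (lact w x)
}.

Section OrbitGroupoid.
Variables (W : groupType) (X : Type) (a : left_action W X).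

Definition orbit_of (x : X) : X -> Prop := fun y => exists w, y = a w x.

Definition orbit_obj : Type := {O : X -> Prop | exists x, O = orbit_of x}.

Definition orbit_elt (O : orbit_obj) : Type := {x : X | sval O x}.

Lemma orbit_act_subproof (O : orbit_obj) w (x : orbit_elt O) :
  sval O (a w (sval x)).
Proof.
case: O x => O [x0 eO] [x /=]; rewrite eO => -[v ->].
by exists (w * v)%g; rewrite lactM.
Qed.

Definition orbit_act (O : orbit_obj) w (x : orbit_elt O) : orbit_elt O :=
  exist _ (a w (sval x)) (orbit_act_subproof w x).

Record orbit_hom (O1 O2 : orbit_obj) := OrbitHom {
  orbit_fun :> orbit_elt O1 -> orbit_elt O2;
  orbit_fun_bij : bijective orbit_fun;
  orbit_funE : forall w x, orbit_fun (orbit_act w x) = orbit_act w (orbit_fun x)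
}.

Lemma orbit_hom_eq O1 O2 (f g : orbit_hom O1 O2) : f =1 g -> f = g.
Proof.
case: f g => f bf ef [g bg eg] /= /funext e; subst g.
by rewrite (Prop_irrelevance bf bg) (Prop_irrelevance ef eg).
Qed.

Definition orbit_id O : orbit_hom O O :=
  @OrbitHom O O id (Bijective (fun _ => erefl) (fun _ => erefl))
    (fun _ _ => erefl).

Lemma orbit_comp_subproof O1 O2 O3 (f : orbit_hom O1 O2) (g : orbit_hom O2 O3) w x :
  (g \o f) (orbit_act w x) = orbit_act w ((g \o f) x).
Proof. by rewrite /= !orbit_funE. Qed.

Definition orbit_comp O1 O2 O3 (f : orbit_hom O1 O2) (g : orbit_hom O2 O3) :
    orbit_hom O1 O3 :=
  OrbitHom (bij_comp (orbit_fun_bij g) (orbit_fun_bij f))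
    (orbit_comp_subproof f g).

Lemma orbit_inv_ex O1 O2 (f : orbit_hom O1 O2) :
  exists g : orbit_hom O2 O1, cancel f g /\ cancel g f.
Proof.
have [g fK gK] := orbit_fun_bij f.
have gE w x : g (orbit_act w x) = orbit_act w (g x).
  by apply: (can_inj fK); rewrite orbit_funE !gK.
by exists (@OrbitHom O2 O1 g (Bijective gK fK) gE).
Qed.

Definition orbit_inv O1 O2 (f : orbit_hom O1 O2) : orbit_hom O2 O1 :=
  sval (cid (orbit_inv_ex f)).

Lemma orbit_compmV O1 O2 (f : orbit_hom O1 O2) :
  orbit_comp f (orbit_inv f) = orbit_id O1.
Proof.
by apply: orbit_hom_eq => x; rewrite /orbit_inv; case: cid => /= g [fK _];
  apply: fK.
Qed.

Lemma orbit_compVm O1 O2 (f : orbit_hom O1 O2) :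
  orbit_comp (orbit_inv f) f = orbit_id O2.
Proof.
by apply: orbit_hom_eq => x; rewrite /orbit_inv; case: cid => /= g [_ gK];
  apply: gK.
Qed.

Definition orbit_groupoid : groupoid.
Proof.
refine (@Groupoid orbit_obj orbit_hom orbit_id orbit_comp orbit_inv
  _ _ _ orbit_compmV orbit_compVm) => *; exact: orbit_hom_eq.
Defined.

End OrbitGroupoid.

Section MutationClass.
Variables (n : nat) (F : fieldType) (iota : {rmorphism rat -> F}).

Record mutation_class := MutationClass {
  in_class :> seed n iota -> Prop;
  mutation_classP : exists x0, forall x,
    in_class x <-> exists g, x = seed_act x0 g
}.

Variable S : mutation_class.

Definition class_elt : Type := {x : seed n iota | S x}.

Lemma class_act_subproof (x : class_elt) g : S (seed_act (sval x) g).
Proof.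
have [x0 SE] := mutation_classP S; have [h ->] := (SE _).1 (svalP x).
by apply/SE; exists (h * g)%g; rewrite seed_actM.
Qed.

Definition class_act (x : class_elt) (g : mutgrp n) : class_elt :=
  exist _ (seed_act (sval x) g) (class_act_subproof x g).

Definition class_quiver : Type :=
  {Q : quiver n | exists x, S x /\ seed_quiver x = Q}.

Definition cmg_symbol (Q1 Q2 : class_quiver) : Type :=
  {g : mutgrp n | quiver_act (sval Q1) g == sval Q2}.

HB.instance Definition _ Q1 Q2 := Choice.on (cmg_symbol Q1 Q2).

Definition cmg_eq (Q1 Q2 : class_quiver) : rel (cmg_symbol Q1 Q2) :=
  fun g h => `[< alpha (sval Q1) (val g) = alpha (sval Q1) (val h) >].

Lemma cmg_eq_refl Q1 Q2 : reflexive (@cmg_eq Q1 Q2).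
Proof. by move=> g; apply/asboolP. Qed.

Lemma cmg_eq_sym Q1 Q2 : ssrbool.symmetric (@cmg_eq Q1 Q2).
Proof. by move=> g h; apply/asboolP/asboolP => ->. Qed.

Lemma cmg_eq_trans Q1 Q2 : transitive (@cmg_eq Q1 Q2).
Proof. by move=> g h k /asboolP hg /asboolP gk; apply/asboolP; rewrite hg. Qed.

Canonical cmg_equiv Q1 Q2 :=
  EquivRel (@cmg_eq Q1 Q2) (@cmg_eq_refl Q1 Q2) (@cmg_eq_sym Q1 Q2)
    (@cmg_eq_trans Q1 Q2).

Definition cmg_hom (Q1 Q2 : class_quiver) : Type := {eq_quot (@cmg_eq Q1 Q2)}.

(* The morphism <Q1, g> : Q1 -> Q2; cmg_classP and cmg_compE give the equality
   and the composition of these symbols. *)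
Definition cmg_class Q1 Q2 (g : cmg_symbol Q1 Q2) : cmg_hom Q1 Q2 :=
  \pi_{eq_quot (@cmg_eq Q1 Q2)} g.

Definition cmg_repr Q1 Q2 (f : cmg_hom Q1 Q2) : cmg_symbol Q1 Q2 :=
  repr (f : {eq_quot (@cmg_eq Q1 Q2)}).

Lemma cmg_reprK Q1 Q2 (f : cmg_hom Q1 Q2) : cmg_class (cmg_repr f) = f.
Proof. exact: reprK. Qed.

Lemma cmg_classP Q1 Q2 (g h : cmg_symbol Q1 Q2) :
  cmg_class g = cmg_class h <->
  alpha (sval Q1) (val g) = alpha (sval Q1) (val h).
Proof.
split=> [/eqmodP/asboolP //|e]; by apply/eqmodP/asboolP.
Qed.

Lemma cmg_symbolP Q1 Q2 (g : cmg_symbol Q1 Q2) :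
  quiver_act (sval Q1) (val g) = sval Q2.
Proof. exact/eqP/(valP g). Qed.

Lemma alpha_cmg_repr Q1 Q2 (g : cmg_symbol Q1 Q2) :
  alpha (sval Q1) (val (cmg_repr (cmg_class g))) = alpha (sval Q1) (val g).
Proof. by apply/cmg_classP; rewrite cmg_reprK. Qed.

Lemma symbol_one_subproof (Q : class_quiver) :
  quiver_act (sval Q) 1%g == sval Q.
Proof. by rewrite quiver_act1. Qed.

Definition symbol_one Q : cmg_symbol Q Q := exist _ 1%g (symbol_one_subproof Q).

Lemma symbol_mul_subproof Q1 Q2 Q3
    (g : cmg_symbol Q1 Q2) (h : cmg_symbol Q2 Q3) :
  quiver_act (sval Q1) (val g * val h)%g == sval Q3.
Proof. by rewrite quiver_actM !cmg_symbolP. Qed.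

Definition symbol_mul Q1 Q2 Q3 (g : cmg_symbol Q1 Q2) (h : cmg_symbol Q2 Q3) :
    cmg_symbol Q1 Q3 :=
  exist _ (val g * val h)%g (symbol_mul_subproof g h).

Lemma symbol_inv_subproof Q1 Q2 (g : cmg_symbol Q1 Q2) :
  quiver_act (sval Q2) (val g)^-1%g == sval Q1.
Proof. by case: g => g /= /eqP <-; rewrite -quiver_actM mulgV quiver_act1. Qed.

Definition symbol_inv Q1 Q2 (g : cmg_symbol Q1 Q2) : cmg_symbol Q2 Q1 :=
  exist _ (val g)^-1%g (symbol_inv_subproof g).

Definition cmg_id Q : cmg_hom Q Q := cmg_class (symbol_one Q).

Definition cmg_comp Q1 Q2 Q3 (f : cmg_hom Q1 Q2) (f' : cmg_hom Q2 Q3) :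
    cmg_hom Q1 Q3 :=
  cmg_class (symbol_mul (cmg_repr f) (cmg_repr f')).

Definition cmg_inv Q1 Q2 (f : cmg_hom Q1 Q2) : cmg_hom Q2 Q1 :=
  cmg_class (symbol_inv (cmg_repr f)).

Lemma cmg_compE Q1 Q2 Q3 (g : cmg_symbol Q1 Q2) (h : cmg_symbol Q2 Q3) :
  cmg_comp (cmg_class g) (cmg_class h) = cmg_class (symbol_mul g h).
Proof.
apply/cmg_classP; by rewrite /= !alphaM !cmg_symbolP !alpha_cmg_repr.
Qed.

Lemma cmg_compA Q1 Q2 Q3 Q4
    (f : cmg_hom Q1 Q2) (g : cmg_hom Q2 Q3) (h : cmg_hom Q3 Q4) :
  cmg_comp f (cmg_comp g h) = cmg_comp (cmg_comp f g) h.
Proof.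
rewrite -[f]cmg_reprK -[g]cmg_reprK -[h]cmg_reprK !cmg_compE.
by apply/cmg_classP; rewrite /= mulgA.
Qed.

Lemma cmg_comp1m Q1 Q2 (f : cmg_hom Q1 Q2) : cmg_comp (cmg_id Q1) f = f.
Proof.
rewrite -[f]cmg_reprK cmg_compE.
by apply/cmg_classP; rewrite /= mul1g.
Qed.

Lemma cmg_compm1 Q1 Q2 (f : cmg_hom Q1 Q2) : cmg_comp f (cmg_id Q2) = f.
Proof.
rewrite -[f]cmg_reprK cmg_compE.
by apply/cmg_classP; rewrite /= mulg1.
Qed.

Lemma cmg_compmV Q1 Q2 (f : cmg_hom Q1 Q2) : cmg_comp f (cmg_inv f) = cmg_id Q1.
Proof.
rewrite -{1}[f]cmg_reprK cmg_compE.
by apply/cmg_classP; rewrite /= mulgV.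
Qed.

Lemma cmg_compVm Q1 Q2 (f : cmg_hom Q1 Q2) : cmg_comp (cmg_inv f) f = cmg_id Q2.
Proof.
rewrite -{2}[f]cmg_reprK cmg_compE.
by apply/cmg_classP; rewrite /= mulVg.
Qed.

Definition CMG : groupoid :=
  Groupoid cmg_compA cmg_comp1m cmg_compm1 cmg_compmV cmg_compVm.

Record class_aut := ClassAut {
  class_aut_fun :> class_elt -> class_elt;
  class_aut_bij : bijective class_aut_fun;
  class_autE : forall x g,
    class_aut_fun (class_act x g) = class_act (class_aut_fun x) g
}.

HB.instance Definition _ := gen_eqMixin class_aut.
HB.instance Definition _ := gen_choiceMixin class_aut.

Lemma class_aut_eq (v w : class_aut) : v =1 w -> v = w.
Proof.
case: v w => v bv ev [w bw ew] /= /funext e; subst w.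
by rewrite (Prop_irrelevance bv bw) (Prop_irrelevance ev ew).
Qed.

Definition class_aut_one : class_aut :=
  @ClassAut id (Bijective (fun _ => erefl) (fun _ => erefl)) (fun _ _ => erefl).

Lemma class_aut_mul_subproof (v w : class_aut) x g :
  (v \o w) (class_act x g) = class_act ((v \o w) x) g.
Proof. by rewrite /= !class_autE. Qed.

Definition class_aut_mul (v w : class_aut) : class_aut :=
  ClassAut (bij_comp (class_aut_bij v) (class_aut_bij w))
    (class_aut_mul_subproof v w).

Lemma class_aut_inv_ex (w : class_aut) :
  exists v : class_aut, cancel w v /\ cancel v w.
Proof.
have [v wK vK] := class_aut_bij w.
have vE x g : v (class_act x g) = class_act (v x) g.
  by apply: (can_inj wK); rewrite class_autE !vK.
by exists (@ClassAut v (Bijective vK wK) vE).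
Qed.

Definition class_aut_inv (w : class_aut) : class_aut :=
  sval (cid (class_aut_inv_ex w)).

Lemma class_aut_mulA : associative class_aut_mul.
Proof. by move=> u v w; apply: class_aut_eq. Qed.

Lemma class_aut_mul1 : left_id class_aut_one class_aut_mul.
Proof. by move=> w; apply: class_aut_eq. Qed.

Lemma class_aut_1mul : right_id class_aut_one class_aut_mul.
Proof. by move=> w; apply: class_aut_eq. Qed.

Lemma class_aut_mulV : left_inverse class_aut_one class_aut_inv class_aut_mul.
Proof.
by move=> w; apply: class_aut_eq => x; rewrite /class_aut_inv;
  case: cid => /= v [wK _]; apply: wK.
Qed.

Lemma class_aut_Vmul : right_inverse class_aut_one class_aut_inv class_aut_mul.
Proof.
by move=> w; apply: class_aut_eq => x; rewrite /class_aut_inv;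
  case: cid => /= v [_ vK]; apply: vK.
Qed.

HB.instance Definition _ := isGroup.Build class_aut
  class_aut_mulA class_aut_mul1 class_aut_1mul class_aut_mulV class_aut_Vmul.

Definition preserves_quivers : {pred class_aut} := fun w =>
  `[< forall x, seed_quiver (sval (w x)) = seed_quiver (sval x) >].

Lemma preserves_quivers_group_closed : group_closed preserves_quivers.
Proof.
split=> [|v w /asboolP vP /asboolP wP]; apply/asboolP => x //.
have e : w (w^-1%g x) = x.
  by rewrite -[LHS]/((w * w^-1)%g x) mulgV.
by rewrite -[in RHS]e wP; apply: vP.
Qed.

Definition Wplus : Type := {w : class_aut | preserves_quivers w}.

HB.instance Definition _ := SubChoice.on Wplus.
HB.instance Definition _ := SubChoice_isSubGroup.Build class_aut
  preserves_quivers Wplus preserves_quivers_group_closed.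

Definition Wplus_action : left_action Wplus class_elt :=
  @LeftAction Wplus class_elt (fun w x => val w x)
    (fun _ => erefl) (fun _ _ _ => erefl).

End MutationClass.

(* Main.v *)
Require Import Defs.
From mathcomp Require Import all_boot all_order all_algebra.
From mathcomp Require Import boolp.

(** The isomorphism sends a quiver Q of the class to the fibre of labelled
    seeds of S with quiver Q, and a morphism <Q, g> to the map x |-> x . g from
    the fibre of Q to the fibre of Q . g.

    Everything rests on one fact, [seed_act_eqP]: on a labelled seed x with
    quiver Q, the elements g and h act equally iff Q . g = Q . h and
    alpha_g^Q = alpha_h^Q.  It holds because the cluster of x . g is the
    isomorphism beta_x \o alpha_g^Q.  The criterion depends on x only through
    its quiver.  This has two consequences.

    - If x and y in S have the same quiver, then x . g |-> y . g is a well
      defined automorphism of the mutation class, and it preserves quivers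
      ([Wplus_transitive]).  Hence the fibres are exactly the orbits of W^+,
      which gives the bijection on objects ([fibre_orbit_bij]).

    - For a fixed target quiver, two symbols <Q, g> and <Q, h> are equal iff g
      and h act equally on one seed with quiver Q, equivalently on all of them.
      So x |-> x . g depends only on the morphism <Q, g> and determines it.
      Every equivariant bijection phi between fibres arises in this way: M_n is
      transitive on S, so phi x = x . g for one seed x of the fibre and some g,
      and then phi (w x) = w (phi x) = (w x) . g for all w in W^+, which is
      transitive on the fibre ([orbit_hom_act]). *)

Set Implicit Arguments.
Unset Strict Implicit.
Unset Printing Implicit Defensive.

Lemma sval_inj (T : Type) (P : T -> Prop) (x y : {z | P z}) :
  sval x = sval y -> x = y.
Proof. by case: x y => [x Px] [y Py] /= e; apply: eq_exist. Qed.

Lemma inj_surj_bij (T U : Type) (f : T -> U) :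
  injective f -> (forall y, exists x, f x = y) -> bijective f.
Proof.
move=> f_inj /choice[g gK]; exists g => // x.
by apply: f_inj; rewrite gK.
Qed.

(** A labelled seed amounts to its quiver together with its isomorphism
    Q(x_1, ..., x_n) -> F, and [alphaE] factors the isomorphism of x . g
    through that of x, which is injective. *)
Lemma seed_act_eqP n (F : fieldType) (iota : {rmorphism rat -> F})
    (x : seed n iota) (g h : mutgrp n) :
  seed_act x g = seed_act x h <->
  quiver_act (seed_quiver x) g = quiver_act (seed_quiver x) h /\
  alpha (seed_quiver x) g = alpha (seed_quiver x) h.
Proof.
split=> [e|[eQ ea]].
  split; first by rewrite -!seed_quiver_act e.
  apply/funext => f; apply: (bij_inj (seed_iso_bij x)).
  have := congr1 (fun y => seed_iso y f) e.
  by rewrite /= !alphaE.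
apply: seed_eq; first by rewrite !seed_quiver_act.
by apply/ffunP => i; rewrite -!seed_iso_var !alphaE /= ea.
Qed.

Section OrbitGroupoidOfMutationClass.
Variables (n : nat) (F : fieldType) (iota : {rmorphism rat -> F}).
Variable S : mutation_class n iota.
Implicit Types (x y z : class_elt S) (g h : mutgrp n) (Q : class_quiver S).

Local Notation quiver_of x := (seed_quiver (sval x)).
Local Notation orbit := (orbit_of (Wplus_action S)).

Lemma quiver_class_act x g :
  quiver_of (class_act x g) = quiver_act (quiver_of x) g.
Proof. exact: seed_quiver_act. Qed.

Lemma class_act1 x : class_act x 1%g = x.
Proof. by apply: sval_inj; rewrite /= seed_act1. Qed.

Lemma class_actM x g h : class_act x (g * h)%g = class_act (class_act x g) h.
Proof. by apply: sval_inj; rewrite /= seed_actM. Qed.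

Lemma class_act_transitive x y : exists g, y = class_act x g.
Proof.
have [x0 SE] := mutation_classP S.
have [g eg] := (SE _).1 (svalP x); have [h eh] := (SE _).1 (svalP y).
exists (g^-1 * h)%g; apply: sval_inj.
by rewrite /= eg eh -seed_actM mulgA mulgV mul1g.
Qed.

Lemma class_act_eqP x g h :
  class_act x g = class_act x h <->
  quiver_act (quiver_of x) g = quiver_act (quiver_of x) h /\
  alpha (quiver_of x) g = alpha (quiver_of x) h.
Proof.
apply: iff_trans (seed_act_eqP (sval x) g h).
by split=> [/(congr1 sval)|e] //; apply: sval_inj.
Qed.

Lemma class_act_eq_transfer x y g h : quiver_of x = quiver_of y ->
  class_act x g = class_act x h -> class_act y g = class_act y h.
Proof. by move=> e /class_act_eqP; rewrite e => /class_act_eqP. Qed.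

(** The automorphism is x . g |-> y . g.  It is well defined and has the inverse
    y . g |-> x . g, because x . g = x . h iff y . g = y . h. *)
Lemma Wplus_transitive x y : quiver_of x = quiver_of y ->
  exists w : Wplus S, y = Wplus_action S w x.
Proof.
move=> exy.
have /choice[c cE] := class_act_transitive x.
have /choice[d dE] := class_act_transitive y.
pose f z := class_act y (c z).
have fE g : f (class_act x g) = class_act y g.
  by apply: (class_act_eq_transfer exy); rewrite -cE.
have f_bij : bijective f.
  exists (fun z => class_act x (d z)) => z; last by rewrite fE -dE.
  by rewrite [RHS]cE; apply: (class_act_eq_transfer (esym exy)); rewrite -dE.
have f_act z g : f (class_act z g) = class_act (f z) g.
  by rewrite [z in LHS]cE -class_actM fE class_actM.
have f_quiver : preserves_quivers (ClassAut f_bij f_act).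
  apply/asboolP => z; rewrite -[ClassAut _ _ z]/(f z).
  by rewrite [z in RHS]cE !quiver_class_act exy.
exists (@exist _ (fun w => preserves_quivers w) _ f_quiver) => /=.
by rewrite -{1}(class_act1 x) fE class_act1.
Qed.

Lemma Wplus_quiver (w : Wplus S) x : quiver_of (Wplus_action S w x) = quiver_of x.
Proof. by case: w => w wP /=; move/asboolP: (wP). Qed.

Lemma orbit_Wplus x : orbit x = fun y => quiver_of y = quiver_of x.
Proof.
apply/funext => y; apply/propext; split=> [[w ->]|e].
  exact: Wplus_quiver.
exact: Wplus_transitive.
Qed.

Definition fibre Q : class_elt S -> Prop := fun x => quiver_of x = sval Q.

Lemma fibre_orbit_subproof Q : exists x, fibre Q = orbit x.
Proof.
case: Q => Q [x [Sx ex]]; exists (exist _ x Sx).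
by rewrite orbit_Wplus /fibre /= ex.
Qed.

Definition fibre_orbit Q : orbit_obj (Wplus_action S) :=
  exist _ (fibre Q) (fibre_orbit_subproof Q).

Lemma fibre_inhabited Q : inhabited (orbit_elt (fibre_orbit Q)).
Proof.
by case: Q => Q [x [Sx ex]]; exists; exists (exist _ x Sx).
Qed.

Lemma fibre_orbit_bij : bijective fibre_orbit.
Proof.
apply: inj_surj_bij => [Q Q' /(congr1 sval) /= e|[O [x eO]]].
  apply: sval_inj; case: (Q) e => Q0 [x [Sx ex]] /= e.
  have : fibre Q' (exist _ x Sx) by rewrite -e /fibre /=.
  by rewrite /fibre /= ex.
exists (exist _ (quiver_of x) (ex_intro _ (sval x) (conj (svalP x) erefl))).
by apply: sval_inj; rewrite /= eO orbit_Wplus.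
Qed.

Section FibreAction.
Variables Q1 Q2 : class_quiver S.
Implicit Type s : cmg_symbol Q1 Q2.

Lemma fibre_act_subproof s (x : orbit_elt (fibre_orbit Q1)) :
  fibre Q2 (class_act (sval x) (val s)).
Proof. by rewrite /fibre quiver_class_act (svalP x) cmg_symbolP. Qed.

Definition fibre_act s (x : orbit_elt (fibre_orbit Q1)) :
    orbit_elt (fibre_orbit Q2) :=
  exist _ (class_act (sval x) (val s)) (fibre_act_subproof s x).

Lemma fibre_actE s (w : Wplus S) (x : orbit_elt (fibre_orbit Q1)) :
  fibre_act s (orbit_act w x) = orbit_act w (fibre_act s x).
Proof. by apply: sval_inj; rewrite /= class_autE. Qed.

End FibreAction.

Lemma fibre_act_bij Q1 Q2 (s : cmg_symbol Q1 Q2) : bijective (fibre_act s).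
Proof.
exists (fibre_act (symbol_inv s)) => x; do 2 apply: sval_inj.
  by rewrite /= -seed_actM mulgV seed_act1.
by rewrite /= -seed_actM mulVg seed_act1.
Qed.

Definition act_hom Q1 Q2 (s : cmg_symbol Q1 Q2) :
    orbit_hom (fibre_orbit Q1) (fibre_orbit Q2) :=
  OrbitHom (fibre_act_bij s) (fibre_actE s).

(** The common target Q2 of the two symbols supplies the condition on quivers
    in [class_act_eqP], so that only the equality of the alphas remains; this
    single equality accounts for all seeds of the fibre. *)
Lemma act_hom_eqP Q1 Q2 (s t : cmg_symbol Q1 Q2) :
  act_hom s = act_hom t <-> cmg_class s = cmg_class t.
Proof.
apply: iff_trans (iff_sym (cmg_classP s t)).
split=> [e|e].
  have [x] := fibre_inhabited Q1.
  have /class_act_eqP[_] : sval (act_hom s x) = sval (act_hom t x) by rewrite e.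
  by rewrite (svalP x).
apply: orbit_hom_eq => x; apply: sval_inj; apply/class_act_eqP.
by rewrite (svalP x) !cmg_symbolP.
Qed.

(** W^+ is transitive on the source, so an equivariant map is determined by one
    value phi x, and M_n is transitive on S, so this value is some x . g. *)
Lemma orbit_hom_act Q1 Q2
    (phi : orbit_hom (fibre_orbit Q1) (fibre_orbit Q2)) :
  exists s : cmg_symbol Q1 Q2, act_hom s = phi.
Proof.
have [x] := fibre_inhabited Q1.
have [g eg] := class_act_transitive (sval x) (sval (phi x)).
have sP : quiver_act (sval Q1) g == sval Q2.
  by apply/eqP; rewrite -(svalP (phi x)) eg quiver_class_act (svalP x).
exists (@exist _ (fun h => quiver_act (sval Q1) h == sval Q2) g sP); apply: orbit_hom_eq => y.
have [w ew] : exists w : Wplus S, sval y = Wplus_action S w (sval x).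
  by apply: Wplus_transitive; rewrite (svalP x) (svalP y).
have -> : y = orbit_act w x by apply: sval_inj.
by rewrite !orbit_funE; congr orbit_act; apply: sval_inj; rewrite /= eg.
Qed.

Definition cmg_act Q1 Q2 (f : cmg_hom Q1 Q2) :
    orbit_hom (fibre_orbit Q1) (fibre_orbit Q2) :=
  act_hom (cmg_repr f).

Lemma cmg_act_class Q1 Q2 (s : cmg_symbol Q1 Q2) :
  cmg_act (cmg_class s) = act_hom s.
Proof. by apply/act_hom_eqP; rewrite cmg_reprK. Qed.

Lemma cmg_act_id Q : cmg_act (cmg_id Q) = Defs.orbit_id (fibre_orbit Q).
Proof.
rewrite cmg_act_class; apply: orbit_hom_eq => x; apply: sval_inj.
exact: class_act1.
Qed.

Lemma cmg_act_comp Q1 Q2 Q3 (f : cmg_hom Q1 Q2) (f' : cmg_hom Q2 Q3) :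
  cmg_act (cmg_comp f f') = orbit_comp (cmg_act f) (cmg_act f').
Proof.
rewrite cmg_act_class; apply: orbit_hom_eq => x; apply: sval_inj.
exact: class_actM.
Qed.

Lemma cmg_act_bij Q1 Q2 : bijective (@cmg_act Q1 Q2).
Proof.
apply: inj_surj_bij => [f f' /act_hom_eqP|phi]; first by rewrite !cmg_reprK.
have [s <-] := orbit_hom_act phi.
by exists (cmg_class s); apply: cmg_act_class.
Qed.

Definition cmg_to_orbit_groupoid :
    groupoid_functor (CMG S) (orbit_groupoid (Wplus_action S)) :=
  @GroupoidFunctor (CMG S) (orbit_groupoid (Wplus_action S))
    fibre_orbit cmg_act cmg_act_id cmg_act_comp.

End OrbitGroupoidOfMutationClass.

Theorem theorem4p2 (n : nat) (hn : (1 <= n)%N) (F : fieldType)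
  (iota : {rmorphism rat -> F}) (hF : purely_transcendental n iota)
  (S : mutation_class n iota) :
  groupoid_isomorphic (CMG S) (orbit_groupoid (Wplus_action S)).
Proof.
exists (cmg_to_orbit_groupoid S); split; first exact: fibre_orbit_bij.
exact: cmg_act_bij.
Qed.
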